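(* Let $\Gamma$ be a variable typing environment and $\Delta$ a safe operator typing environment such that the multi-threaded programs $M_1$ and $M_2$ are well-typed. Assume $\mu\vDash M_1\approx_{\Gamma,\Delta}\sigma\vDash M_2$. If $\mu\vDash M_1\to_g\mu'\vDash M_1'$, then there exist $\sigma'$ and $M_2'$ such that $\sigma\vDash M_2\to_g^*\sigma'\vDash M_2'$ and $\mu'\vDash M_1'\approx_{\Gamma,\Delta}\sigma'\vDash M_2'$.
   Context: Words: $\mathcal{W}$ is the set of finite words over a finite alphabet $\Sigma$, containing distinguished words $\texttt{tt},\texttt{ff}$. Operators $op$ have fixed arity $n\ge0$ and are interpreted as total functions $[\![op]\!]:\mathcal{W}^n\to\mathcal{W}$. Expressions: $E ::= X \mid op(E_1,\dots,E_n)$ ($X$ a variable). Commands: $C ::= X:=E \mid C;C' \mid \texttt{skip}\mid \texttt{if } E\texttt{ then } C\texttt{ else } C'\mid\texttt{while}(E)\{C\}$. A multi-threaded program $M$ is a finite map from thread identifiers to commands; $\emptyset$ is the empty program, $M-x$ the restriction of $M$ to $\mathrm{dom}(M)\setminus\{x\}$, $M[x:=C]$ the update. A store $\mu$ maps variables to words. Expression evaluation $\mu\vDash E\Downarrow d$: $X$ evaluates to $\mu(X)$, $op(E_1,\dots,E_n)$ to $[\![op]\!](d_1,\dots,d_n)$. Small-step relation $\to_s$ on configurations ($\mu\vDash C$ or a store): $\mu\vDash\texttt{skip}\to_s\mu$; $\mu\vDash X:=E\to_s\mu[X\leftarrow d]$ where $\mu\vDash E\Downarrow d$; if $\mu\vDash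 C_1\to_s\mu_1$ then $\mu\vDash C_1;C_2\to_s\mu_1\vDash C_2$; if $\mu\vDash C_1\to_s\mu_1\vDash C_1'$ then $\mu\vDash C_1;C_2\to_s\mu_1\vDash C_1';C_2$; if $\mu\vDash E\Downarrow w\in\{\texttt{tt},\texttt{ff}\}$ then $\mu\vDash\texttt{if }E\texttt{ then }C_{\texttt{tt}}\texttt{ else }C_{\texttt{ff}}\to_s\mu\vDash C_w$; if $E$ evaluates to $\texttt{ff}$ then $\mu\vDash\texttt{while}(E)\{C\}\to_s\mu$; if to $\texttt{tt}$ then $\mu\vDash\texttt{while}(E)\{C\}\to_s\mu\vDash C;\texttt{while}(E)\{C\}$. Global relation $\to_g$ (nondeterministic choice of thread): if $M(x)=C$ and $\mu\vDash C\to_s\mu_1$ then $\mu\vDash M\to_g\mu_1\vDash M-x$; if $M(x)=C$ and $\mu\vDash C\to_s\mu_1\vDash C_1$ then $\mu\vDash M\to_g\mu_1\vDash M[x:=C_1]$. $\to_g^*$ is the reflexive-transitive closure. Tiers $\mathbf{0}\preceq\mathbf{1}$ with $\vee,\wedge$. $\Gamma$ maps variables to tiers; $\Delta$ maps each operator of arity $n$ to a set of types $\alpha_1\to\cdots\to\alpha_n\to\alpha$. Typing: $\Gamma,\Delta\vdash X:\Gamma(X)$; $op(E_1,\dots,E_n):\alpha$ if $E_i:\alpha_i$ and $\alpha_1\to\cdots\to\alpha_n\to\alpha\in\Delta(op)$; $X:=E:\beta$ if $X:\beta$, $E:\alpha$, $\beta\preceq\alpha$; $C;C':\alpha\vee\beta$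 if $C:\alpha$, $C':\beta$; $\texttt{skip}:\alpha$ for any $\alpha$; $\texttt{if }E\texttt{ then }C\texttt{ else }C':\alpha$ if $E,C,C'$ all have type $\alpha$; $\texttt{while}(E)\{C\}:\mathbf{1}$ if $E:\mathbf{1}$ and $C:\alpha$ for some $\alpha$. $M$ is well-typed if for every $x\in\mathrm{dom}(M)$, $\Gamma,\Delta\vdash M(x):\alpha$ for some tier $\alpha$. Neutral operator: $[\![op]\!]$ takes only values $\texttt{tt},\texttt{ff}$, or for all arguments the result is a sub-word (factor $w=uvu'$) of some argument. Positive operator: $|[\![op]\!](d_1,\dots,d_n)|\le\max_i|d_i|+c$ for a constant $c$. Standing assumption: every operator is neutral or positive. $\Delta$ is safe if every type $\alpha_1\to\cdots\to\alpha_n\to\alpha\in\Delta(op)$ satisfies $\alpha\preceq\bigwedge_i\alpha_i$, and $\alpha=\mathbf{0}$ if $op$ is positive but not neutral. Equivalence: $\mu\approx_{\Gamma,\Delta}\sigma$ iff $\mu(X)=\sigma(X)$ for all $X\in\mathrm{dom}(\Gamma)$ with $\Gamma(X)=\mathbf{1}$. On commands, $\approx_{\Gamma,\Delta}$ is the least relation with: $C\approx C$; $C\approx C'$ whenever both have type $\mathbf{0}$ under $\Gamma,\Delta$; $C\approx C'$ and $D\approx D'$ imply $C;D\approx C';D'$. On programs: $M\approx M'$ iff $\mathrm{dom}(M)=\mathrm{dom}(M')$ and $M(x)\approx M'(x)$ for all $x$. On configurations: $\mu\vDash M\approx_{\Gamma,\Delta}\sigma\vDash M'$ iff $M\approx M'$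 and $\mu\approx\sigma$.
   Formalization: Adds the assumption that in every execution from σ⊨M2, a tier-0 conditional about to run has a guard evaluating to tt or ff; without it the claim fails, e.g. M1 = skip and M2 = if X then skip else skip with X of tier 0 holding another word. *)

(* Defs.v *)
From Stdlib Require Export Relation_Operators.
From mathcomp Require Export all_boot all_order.
From mathcomp Require Export finmap.

Set Implicit Arguments.
Unset Strict Implicit.
Unset Printing Implicit Defensive.

Local Open Scope fmap_scope.

(* Words over a finite alphabet, the two truth values, and the operators with
   their arities and interpretations. *)
Record signature := Signature {
  alphabet : finType;
  tt_word : seq alphabet;
  ff_word : seq alphabet;
  tt_neq_ff : tt_word != ff_word;
  op : Type;
  arity : op -> nat;
  interp : forall o : op, {ffun 'I_(arity o) -> seq alphabet} -> seq alphabet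
}.

Definition word (S : signature) : Type := seq (alphabet S).

Section Language.

Variables (V : eqType) (S : signature).

Inductive expr : Type :=
| Var of V
| App (o : op S) of {ffun 'I_(arity o) -> expr}.

Inductive cmd : Type :=
| Assign of V & expr
| Seq of cmd & cmd
| Skip
| If of expr & cmd & cmd
| While of expr & cmd.

Definition store : Type := V -> word S.

Definition upd (mu : store) (X : V) (d : word S) : store :=
  fun Y => if Y == X then d else mu Y.

(* Stores and operators are total, so evaluation is a function. *)
Fixpoint eval (mu : store) (E : expr) : word S :=
  match E with
  | Var X => mu X
  | App o Es => interp [ffun i => eval mu (Es i)]
  end.

Inductive config : Type :=
| Run of store & cmd
| Done of store.

Inductive step : config -> config -> Prop :=
| step_skip mu :
    step (Run mu Skip) (Done mu)
| step_assign mu X E :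
    step (Run mu (Assign X E)) (Done (upd mu X (eval mu E)))
| step_seq_done mu mu1 C1 C2 :
    step (Run mu C1) (Done mu1) ->
    step (Run mu (Seq C1 C2)) (Run mu1 C2)
| step_seq_run mu mu1 C1 C1' C2 :
    step (Run mu C1) (Run mu1 C1') ->
    step (Run mu (Seq C1 C2)) (Run mu1 (Seq C1' C2))
| step_if_tt mu E C C' :
    eval mu E = tt_word S ->
    step (Run mu (If E C C')) (Run mu C)
| step_if_ff mu E C C' :
    eval mu E = ff_word S ->
    step (Run mu (If E C C')) (Run mu C')
| step_while_ff mu E C :
    eval mu E = ff_word S ->
    step (Run mu (While E C)) (Done mu)
| step_while_tt mu E C :
    eval mu E = tt_word S ->
    step (Run mu (While E C)) (Run mu (Seq C (While E C))).

(* The tiers 0 and 1 are [false] and [true], with the lattice structure of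
   [bool]. *)
Definition tier : Type := bool.
Definition tier0 : tier := false.
Definition tier1 : tier := true.

(* [(a, b) : op_type n] is the type a_1 -> ... -> a_n -> b. *)
Definition op_type (n : nat) : Type := ({ffun 'I_n -> tier} * tier)%type.

(* [G X = None] when X is outside the domain of G. *)
Definition var_env : Type := V -> option tier.
Definition op_env : Type := forall o : op S, op_type (arity o) -> Prop.

Section Typing.

Variables (G : var_env) (D : op_env).

Inductive expr_typed : expr -> tier -> Prop :=
| ty_var X a :
    G X = Some a -> expr_typed (Var X) a
| ty_app (o : op S) (Es : {ffun 'I_(arity o) -> expr})
    (a : {ffun 'I_(arity o) -> tier}) (b : tier) :
    (forall i, expr_typed (Es i) (a i)) ->
    D (a, b) ->
    expr_typed (App Es) b.

Inductive cmd_typed : cmd -> tier -> Prop :=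
| ty_assign X E a b :
    expr_typed (Var X) b -> expr_typed E a -> (b <= a)%O ->
    cmd_typed (Assign X E) b
| ty_seq C C' a b :
    cmd_typed C a -> cmd_typed C' b ->
    cmd_typed (Seq C C') (Order.join a b)
| ty_skip a :
    cmd_typed Skip a
| ty_if E C C' a :
    expr_typed E a -> cmd_typed C a -> cmd_typed C' a ->
    cmd_typed (If E C C') a
| ty_while E C a :
    expr_typed E tier1 -> cmd_typed C a ->
    cmd_typed (While E C) tier1.

Definition store_equiv (mu sigma : store) : Prop :=
  forall X, G X = Some tier1 -> mu X = sigma X.

Inductive cmd_equiv : cmd -> cmd -> Prop :=
| ce_refl C :
    cmd_equiv C C
| ce_tier0 C C' :
    cmd_typed C tier0 -> cmd_typed C' tier0 -> cmd_equiv C C'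
| ce_seq C C' D D' :
    cmd_equiv C C' -> cmd_equiv D D' -> cmd_equiv (Seq C D) (Seq C' D').

End Typing.

Definition neutral (o : op S) : Prop :=
  (forall d, @interp S o d = tt_word S \/ @interp S o d = ff_word S) \/
  (forall d, exists i, infix (@interp S o d) (d i)).

Definition positive (o : op S) : Prop :=
  exists c : nat, forall d,
    size (@interp S o d) <= \max_(i < arity o) size (d i) + c.

(* For a nullary operator the meet is the top tier 1. *)
Definition safe (D : op_env) : Prop :=
  forall (o : op S) (a : {ffun 'I_(arity o) -> tier}) (b : tier),
    D o (a, b) ->
    (b <= \meet_(i < arity o) a i)%O /\
    (positive o -> ~ neutral o -> b = tier0).

Variable T : choiceType.

Definition program : Type := {fmap T -> cmd}.

Definition gconfig : Type := (store * program)%type.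

Inductive gstep : gconfig -> gconfig -> Prop :=
| gstep_done mu mu1 (M : program) x C :
    M.[? x] = Some C ->
    step (Run mu C) (Done mu1) ->
    gstep (mu, M) (mu1, M.[~ x])
| gstep_run mu mu1 (M : program) x C C1 :
    M.[? x] = Some C ->
    step (Run mu C) (Run mu1 C1) ->
    gstep (mu, M) (mu1, M.[x <- C1]).

Definition gsteps : gconfig -> gconfig -> Prop := clos_refl_trans gconfig gstep.

Fixpoint active (C : cmd) : cmd :=
  match C with Seq C1 _ => active C1 | _ => C end.

(* A conditional whose guard evaluates to neither truth value blocks its thread
   forever.  This says that no execution from [c] is about to run such a
   conditional of tier 0; other conditionals and loops are unconstrained.  It is
   what a simulation needs: [if X then skip else skip] and [skip] are equivalent
   when X has tier 0, but only the second is sure to terminate. *)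
Definition tier0_guards_boolean (G : var_env) (D : op_env) (c : gconfig) : Prop :=
  forall mu (M : program), gsteps c (mu, M) ->
  forall x C E C1 C2, M.[? x] = Some C -> active C = If E C1 C2 ->
  cmd_typed G D (If E C1 C2) tier0 ->
  eval mu E = tt_word S \/ eval mu E = ff_word S.

Definition well_typed (G : var_env) (D : op_env) (M : program) : Prop :=
  forall x C, M.[? x] = Some C -> exists a, cmd_typed G D C a.

Definition prog_equiv (G : var_env) (D : op_env) (M M' : program) : Prop :=
  domf M = domf M' /\
  forall x C C', M.[? x] = Some C -> M'.[? x] = Some C' -> cmd_equiv G D C C'.

Definition gconfig_equiv (G : var_env) (D : op_env) (c c' : gconfig) : Prop :=
  prog_equiv G D c.2 c'.2 /\ store_equiv G c.1 c'.1.

End Language.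

(* Main.v *)
Require Import Defs.

(** Tier-1 expressions read only tier-1 variables, so two equivalent stores agree
    on every tier-1 guard and on every value assigned to a tier-1 variable: there
    the second program copies the step of the first.  Commands of tier 0 contain
    no loop and write no tier-1 variable.  A step inside one is therefore matched
    by no step at all, and when it terminates the second program runs its own
    tier-0 command to completion, which succeeds because its guards are Boolean. *)

Set Implicit Arguments.
Unset Strict Implicit.

Local Open Scope fmap_scope.

Lemma clos_refl_trans_map (A B : Type) (R : A -> A -> Prop)
    (Q : B -> B -> Prop) (f : A -> B) :
  (forall a b, R a b -> Q (f a) (f b)) ->
  forall a b, clos_refl_trans A R a b -> clos_refl_trans B Q (f a) (f b).
Proof.
move=> RQ a b; elim=> [x y /RQ|x|x y z _ xy _ yz]; first exact: rt_step.
  exact: rt_refl.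
exact: rt_trans xy yz.
Qed.

Section Simulation.

Variables (V : eqType) (S : signature) (G : var_env V) (D : op_env S).
Hypothesis D_safe : safe D.

Local Notation steps := (clos_refl_trans _ (@step V S)).

(** * Tier-1 expressions and equivalence of stores *)

Lemma safe_tier1_args (o : op S) (a : {ffun 'I_(arity o) -> tier}) :
  D (a, tier1) -> forall i, a i = tier1.
Proof.
case/D_safe=> /Order.TMeetTheory.meetsP le1 _ i.
by move: (le1 i isT); case: (a i).
Qed.

(** Safety puts the result tier of an operator below the meet of its argument tiers, so every
    subexpression of a tier-1 expression has tier 1, down to variables on which the stores agree. *)
Lemma eval_tier1 (mu sigma : store V S) E :
  store_equiv G mu sigma -> expr_typed G D E tier1 ->
  eval mu E = eval sigma E.
Proof.
move=> eq_st; move Eb: tier1 => b tyE.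
elim: tyE Eb => [X a GX eq_a|o Es a c _ IH Dac eq_c] /=.
  by apply: eq_st; rewrite eq_a.
rewrite -{}eq_c in Dac; congr interp; apply/ffunP => i; rewrite !ffunE.
by apply: IH; rewrite (safe_tier1_args Dac).
Qed.

Lemma store_equiv_trans (mu nu sigma : store V S) :
  store_equiv G mu nu -> store_equiv G nu sigma -> store_equiv G mu sigma.
Proof. by move=> mn ns X GX; rewrite mn // ns. Qed.

Lemma store_equiv_sym (mu sigma : store V S) :
  store_equiv G mu sigma -> store_equiv G sigma mu.
Proof. by move=> ms X GX; rewrite ms. Qed.

(** The values are compared only when [X] has tier 1, so assignments of both tiers are covered. *)
Lemma store_equiv_upd (mu sigma : store V S) X d e :
  store_equiv G mu sigma -> (G X = Some tier1 -> d = e) ->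
  store_equiv G (upd mu X d) (upd sigma X e).
Proof.
by move=> ms de Y GY; rewrite /upd; case: eqP GY => [-> /de|_ /ms].
Qed.

Lemma store_equiv_upd_tier0 (mu : store V S) X d :
  G X = Some tier0 -> store_equiv G mu (upd mu X d).
Proof. by move=> GX Y; rewrite /upd; case: eqP => // ->; rewrite GX. Qed.

(** * Inversion of typing derivations *)

Lemma typed_Assign X (E : expr V S) a : cmd_typed G D (Assign X E) a ->
  G X = Some a /\ exists2 b, (a <= b)%O & expr_typed G D E b.
Proof.
move=> ty; inversion ty as [? ? b c tyX tyE le_cb| | | |]; subst.
by inversion tyX; split=> //; exists b.
Qed.

Lemma typed_Seq (C C' : cmd V S) a : cmd_typed G D (Seq C C') a ->
  exists b c, [/\ cmd_typed G D C b, cmd_typed G D C' c & a = Order.join b c].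
Proof.
by move=> ty; inversion ty as [|? ? b c tyC tyC'| | |]; exists b, c.
Qed.

Lemma typed_Seq_tier0 (C C' : cmd V S) : cmd_typed G D (Seq C C') tier0 ->
  cmd_typed G D C tier0 /\ cmd_typed G D C' tier0.
Proof. by case/typed_Seq=> [[]] [[]] []. Qed.

Lemma typed_If (E : expr V S) C C' a : cmd_typed G D (If E C C') a ->
  [/\ expr_typed G D E a, cmd_typed G D C a & cmd_typed G D C' a].
Proof. by move=> ty; inversion ty. Qed.

Lemma typed_While (E : expr V S) C a : cmd_typed G D (While E C) a ->
  a = tier1 /\ expr_typed G D E tier1.
Proof. by move=> ty; inversion ty. Qed.

(** * Execution inside a sequential composition *)

Definition seq_config (C2 : cmd V S) (c : config V S) : config V S :=
  match c with
  | Run mu C1 => Run mu (Seq C1 C2)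
  | Done mu => Run mu C2
  end.

(** With [seq_config C2] as an evaluation context, the two rules for [Seq] become one congruence. *)
Lemma step_seq_config C2 c c' :
  step c c' -> step (seq_config C2 c) (seq_config C2 c').
Proof.
case: c c' => [mu C|mu] [mu' C'|mu'] st /=; try by inversion st.
  exact: step_seq_run.
exact: step_seq_done.
Qed.

Lemma steps_seq_config C2 c c' :
  steps c c' -> steps (seq_config C2 c) (seq_config C2 c').
Proof. exact: clos_refl_trans_map (@step_seq_config C2) _ _. Qed.

Lemma step_Seq_inv mu C1 C2 c : step (Run mu (Seq C1 C2)) c ->
  exists2 c1, step (Run mu C1) c1 & c = seq_config C2 c1.
Proof.
move=> st; inversion st as [| |? mu1 ? ? st1|? mu1 ? C1' ? st1| | | |]; subst.
  by exists (Done mu1).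
by exists (Run mu1 C1').
Qed.

(* [tier0_guards_boolean] restricted to the execution of a single thread. *)
Definition guards_boolean (c : config V S) : Prop :=
  forall mu C, steps c (Run mu C) ->
  forall E C1 C2, active C = If E C1 C2 -> cmd_typed G D (If E C1 C2) tier0 ->
  eval mu E = tt_word S \/ eval mu E = ff_word S.

(** * Tier-0 commands under Boolean guards *)

Lemma guards_boolean_steps c c' :
  steps c c' -> guards_boolean c -> guards_boolean c'.
Proof. by move=> cc' gb mu C c'C; apply: gb; apply: rt_trans cc' c'C. Qed.

(** Executions of [C1] lift to the composition with the same stores, and [active] descends into the
    first component, so the same guards are about to be tested. *)
Lemma guards_boolean_Seq mu C1 C2 :
  guards_boolean (Run mu (Seq C1 C2)) -> guards_boolean (Run mu C1).
Proof. by move=> gb nu C /(steps_seq_config C2); apply: gb. Qed.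

(** Structural induction suffices: a loop, the only command that unfolds to a larger one, never has
    tier 0. *)
Lemma tier0_terminates sigma C :
  cmd_typed G D C tier0 -> guards_boolean (Run sigma C) ->
  exists2 sigma', steps (Run sigma C) (Done sigma') &
                  store_equiv G sigma sigma'.
Proof.
elim: C sigma => [X E|C1 IH1 C2 IH2||E C1 IH1 C2 IH2|E C _] sigma.
- case/typed_Assign=> GX _ _; exists (upd sigma X (eval sigma E)).
    by apply: rt_step; apply: step_assign.
  exact: store_equiv_upd_tier0.
- case/typed_Seq_tier0=> ty1 ty2 gb.
  have [s1 /(steps_seq_config C2) st1 eq1] :=
    IH1 sigma ty1 (guards_boolean_Seq gb).
  (* The composition itself has reached [C2], so its guard hypothesis passes to [C2]. *)
  have [s2 st2 eq2] := IH2 s1 ty2 (guards_boolean_steps st1 gb).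
  by exists s2; [apply: rt_trans st1 st2 | apply: store_equiv_trans eq1 eq2].
- by move=> _ _; exists sigma => //; apply: rt_step; apply: step_skip.
- move=> ty gb; have [_ ty1 ty2] := typed_If ty.
  have [ev|ev] := gb _ _ (rt_refl _ _ _) _ _ _ erefl ty.
    have st := rt_step _ _ _ _ (step_if_tt C1 C2 ev).
    have [s st' eqs] := IH1 sigma ty1 (guards_boolean_steps st gb).
    by exists s => //; apply: rt_trans st st'.
  have st := rt_step _ _ _ _ (step_if_ff C1 C2 ev).
  have [s st' eqs] := IH2 sigma ty2 (guards_boolean_steps st gb).
  by exists s => //; apply: rt_trans st st'.
- by case/typed_While.
Qed.

(** Subject reduction and non-interference at tier 0: this is what lets the other thread stand
    still. *)
Lemma tier0_step mu C c : cmd_typed G D C tier0 -> step (Run mu C) c ->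
  match c with
  | Run mu' C' => cmd_typed G D C' tier0 /\ store_equiv G mu mu'
  | Done mu' => store_equiv G mu mu'
  end.
Proof.
elim: C c => [X E|C1 IH1 C2 _||E C1 _ C2 _|E C _] c ty.
- move=> st; inversion st; subst; have [GX _] := typed_Assign ty.
  exact: store_equiv_upd_tier0.
- have [ty1 ty2] := typed_Seq_tier0 ty.
  case/step_Seq_inv=> c1 /(IH1 _ ty1) + ->.
  case: c1 => [mu1 C1' [ty1' eq1]|mu1 eq1] /=; split=> //.
  exact: (@ty_seq _ _ G D _ _ tier0 tier0).
- by move=> st; inversion st.
- by move=> st; have [_ ty1 ty2] := typed_If ty; inversion st; subst.
- by case/typed_While: ty.
Qed.

(** * Simulation of a single thread *)

Definition config_equiv (c c' : config V S) : Prop :=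
  match c, c' with
  | Run mu C, Run sigma C' => store_equiv G mu sigma /\ cmd_equiv G D C C'
  | Done mu, Done sigma => store_equiv G mu sigma
  | _, _ => False
  end.

Lemma config_equiv_seq C2 C2' c c' : cmd_equiv G D C2 C2' ->
  config_equiv c c' -> config_equiv (seq_config C2 c) (seq_config C2' c').
Proof.
move=> eq2; case: c c' => [mu C|mu] [sigma C'|sigma] //= [eqs eqC].
by split=> //; apply: ce_seq.
Qed.

Lemma step_refl_simulated C a mu sigma c : cmd_typed G D C a ->
  store_equiv G mu sigma -> step (Run mu C) c ->
  exists2 c', steps (Run sigma C) c' & config_equiv c c'.
Proof.
move=> + eq_st.
elim: C a c => [X E|C1 IH1 C2 _||E C1 _ C2 _|E C _] a c ty st.
- inversion st; subst; exists (Done (upd sigma X (eval sigma E))).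
    by apply: rt_step; apply: step_assign.
  apply: store_equiv_upd => // GX; apply: eval_tier1 => //.
  (* The tier of [E] is at least that of [X], so it is 1 when [X] has tier 1. *)
  by have [] := typed_Assign ty; rewrite GX => -[<-] [[]].
- have [b [_ [ty1 _ _]]] := typed_Seq ty.
  have [c1 /(IH1 _ _ ty1)[c' st' eqc] ->] := step_Seq_inv st.
  exists (seq_config C2 c'); first exact: (steps_seq_config C2 st').
  by apply: config_equiv_seq => //; apply: ce_refl.
- inversion st; subst.
  by exists (Done sigma) => //; apply: rt_step; apply: step_skip.
- have [tyE ty1 ty2] := typed_If ty.
  case: a => [|] in ty tyE ty1 ty2.
    have evE := eval_tier1 eq_st tyE.
    inversion st as [| | | |? ? ? ? ev|? ? ? ? ev| |]; subst; rewrite evE in ev.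
      exists (Run sigma C1); first by apply: rt_step; apply: step_if_tt.
      by split=> //; apply: ce_refl.
    exists (Run sigma C2); first by apply: rt_step; apply: step_if_ff.
    by split=> //; apply: ce_refl.
  (* At tier 0 the stores may disagree on the guard. The second thread waits: its conditional and
     the branch chosen by the first both have tier 0. *)
  exists (Run sigma (If E C1 C2)); first exact: rt_refl.
  by inversion st; subst; split=> //; apply: ce_tier0.
- have [_ tyE] := typed_While ty.
  have evE := eval_tier1 eq_st tyE.
  inversion st as [| | | | | |? ? ? ev|? ? ? ev]; subst; rewrite evE in ev.
    by exists (Done sigma) => //; apply: rt_step; apply: step_while_ff.
  exists (Run sigma (Seq C (While E C))).
    by apply: rt_step; apply: step_while_tt.
  by split=> //; apply: ce_refl.
Qed.

(** Induction on the equivalence. In the tier-0 clause the second thread waits while the first still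
    runs, and runs to its end once the first terminates; Boolean guards make this possible. In a
    composition only the first components move. *)
Lemma step_simulated C C' a mu sigma c :
  cmd_equiv G D C C' -> cmd_typed G D C a -> store_equiv G mu sigma ->
  guards_boolean (Run sigma C') -> step (Run mu C) c ->
  exists2 c', steps (Run sigma C') c' & config_equiv c c'.
Proof.
move=> eqC + eq_st; elim: eqC a c => {C C'}.
- by move=> C a c ty _; apply: step_refl_simulated ty eq_st.
- move=> C C' tyC tyC' _ [mu1 C1|mu1] _ gb /(tier0_step tyC).
    case=> tyC1 /store_equiv_sym eq1; exists (Run sigma C').
      exact: rt_refl.
    by split; [apply: store_equiv_trans eq1 eq_st | apply: ce_tier0].
  move=> /store_equiv_sym eq1; have [s st eqs] := tier0_terminates tyC' gb.
  exists (Done s) => //.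
  exact: store_equiv_trans eq1 (store_equiv_trans eq_st eqs).
- move=> C C' E E' _ IH eqE _ a c /typed_Seq[b [_ [tyC _ _]]].
  move=> /guards_boolean_Seq gb /step_Seq_inv[c1 st ->].
  have [c' st' eqc] := IH _ _ tyC gb st.
  exists (seq_config E' c'); first exact: (steps_seq_config E' st').
  exact: config_equiv_seq.
Qed.

(** * Lifting from one thread to programs *)

Variable T : choiceType.

(** Both rules of [gstep] become images of [step] under this map. What [M] holds at [x] is
    irrelevant, so [M] stays fixed along a whole execution of the thread. *)
Definition thread_gconfig (M : program V S T) (x : T) (c : config V S) :
    gconfig V S T :=
  match c with
  | Run mu C => (mu, M.[x <- C])
  | Done mu => (mu, M.[~ x])
  end.

Lemma thread_gconfig_id (M : program V S T) x mu C :
  M.[? x] = Some C -> thread_gconfig M x (Run mu C) = (mu, M).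
Proof.
move=> Mx; congr pair; apply/fmapP => y; rewrite fnd_set.
by case: eqP => // ->.
Qed.

Lemma gstep_thread (M : program V S T) x c c' :
  step c c' -> gstep (thread_gconfig M x c) (thread_gconfig M x c').
Proof.
case: c => [mu C|mu] st; last by inversion st.
have Mx : M.[x <- C].[? x] = Some C by rewrite fnd_set eqxx.
case: c' st => [mu' C'|mu'] st /=.
  have := gstep_run Mx st.
  suff -> : M.[x <- C].[x <- C'] = M.[x <- C'] by [].
  by apply/fmapP => y; rewrite !fnd_set; case: eqP.
have := gstep_done Mx st.
suff -> : M.[x <- C].[~ x] = M.[~ x] by [].
by apply/fmapP => y; rewrite !fnd_rem1 fnd_set; case: eqP.
Qed.

Lemma gsteps_thread (M : program V S T) x c c' :
  steps c c' -> gsteps (thread_gconfig M x c) (thread_gconfig M x c').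
Proof. exact: clos_refl_trans_map (@gstep_thread M x) _ _. Qed.

Lemma gstep_inv mu (M : program V S T) g : gstep (mu, M) g ->
  exists x C c, [/\ M.[? x] = Some C, step (Run mu C) c &
                    g = thread_gconfig M x c].
Proof.
move=> st; inversion st as [? mu1 ? x C Mx st1|? mu1 ? x C C1 Mx st1]; subst.
  by exists x, C, (Done mu1).
by exists x, C, (Run mu1 C1).
Qed.

(** Domains stay equal because [config_equiv] rejects pairs in which only one thread has
    terminated. *)
Lemma gconfig_equiv_thread (M M' : program V S T) x c c' :
  prog_equiv G D M M' -> config_equiv c c' ->
  gconfig_equiv G D (thread_gconfig M x c) (thread_gconfig M' x c').
Proof.
move=> [eq_dom eqM].
case: c c' => [mu C|mu] [sigma C'|sigma] //= => [[eqs eqC]|eqs].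
  have eq_dom' : domf M.[x <- C] = domf M'.[x <- C'].
    by rewrite !dom_setf eq_dom.
  split=> //; split=> // y B B'; rewrite !fnd_set.
  by case: eqP => [_ [<-] [<-] //|_]; apply: eqM.
have eq_dom' : domf M.[~ x] = domf M'.[~ x] by rewrite !domf_rem eq_dom.
split=> //; split=> // y B B'; rewrite !fnd_rem1.
by case: eqP => //= _; apply: eqM.
Qed.

(** Scheduling [x] alone is one of the executions of the program. *)
Lemma guards_boolean_thread sigma (M : program V S T) x C :
  tier0_guards_boolean G D (sigma, M) -> M.[? x] = Some C ->
  guards_boolean (Run sigma C).
Proof.
move=> gb Mx nu C' /(gsteps_thread M x); rewrite (thread_gconfig_id _ Mx).
by move=> st E C1 C2; apply: (gb _ _ st x); rewrite fnd_set eqxx.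
Qed.

End Simulation.

Theorem theorem2 (V : eqType) (S : signature) (T : choiceType)
  (hop : forall o : op S, neutral o \/ positive o)
  (G : var_env V) (D : op_env S) (hsafe : safe D)
  (mu sigma mu' : store V S) (M1 M2 M1' : program V S T)
  (hM1 : well_typed G D M1) (hM2 : well_typed G D M2)
  (hbool : tier0_guards_boolean G D (sigma, M2))
  (hequiv : gconfig_equiv G D (mu, M1) (sigma, M2))
  (hstep : gstep (mu, M1) (mu', M1')) :
  exists (sigma' : store V S) (M2' : program V S T),
    gsteps (sigma, M2) (sigma', M2') /\
    gconfig_equiv G D (mu', M1') (sigma', M2').
Proof.
have [x [C [c [M1x st ->]]]] := gstep_inv hstep.
have [/= eqM eqs] := hequiv; have [eq_dom eqC] := eqM.
have : M2.[? x].
  by rewrite fndSome -[x \in M2]/(x \in domf M2) -eq_dom -fndSome M1x.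
case M2x: M2.[? x] => [C'|] // _.
have [a ty] := hM1 _ _ M1x.
(* The second program answers with its own thread [x] and leaves all others untouched. *)
have [c' st' eqc] := step_simulated hsafe (eqC _ _ _ M1x M2x) ty eqs
  (guards_boolean_thread hbool M2x) st.
have := gsteps_thread M2 x st'; rewrite (thread_gconfig_id _ M2x).
have := gconfig_equiv_thread x eqM eqc.
by case: (thread_gconfig M2 x c') => s' M2'; exists s', M2'.
Qed.
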